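(* For every cardinal $\kappa\leq\aleph_0$, there exists $L\in\mathsf{NExt}(\mathsf{S4}_t)$ with $|\mathsf{PTAB}(L)|=\kappa$.
   Context: Tense formulas use $\Box$ (future necessity) and a past possibility operator written here $\mathsf{P}$; $\mathsf{S4}_t=\mathsf{K}_t\oplus\{\Box p\to p,\Box p\to\Box\Box p\}$; $\mathsf{NExt}(L)$ is the set of tense logics extending $L$; a logic is pretabular if it is not the logic of a finite frame but all its consistent proper extensions are; $\mathsf{PTAB}(L)$ is the set of pretabular logics in $\mathsf{NExt}(L)$. *)

(* Defs.v *)
From mathcomp Require Import all_boot.
From mathcomp Require Import boolp classical_sets functions cardinality.

Set Implicit Arguments.
Unset Strict Implicit.
Unset Printing Implicit Defensive.

Local Open Scope classical_set_scope.

Inductive form : Type :=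
| Var of nat
| Bot
| Imp of form & form
| Box of form   (* future necessity *)
| PDia of form. (* past possibility *)

Fixpoint subst (s : nat -> form) (a : form) : form :=
  match a with
  | Var n => s n
  | Bot => Bot
  | Imp a b => Imp (subst s a) (subst s b)
  | Box a => Box (subst s a)
  | PDia a => PDia (subst s a)
  end.

(* Boolean evaluation in which variables and modal formulas count as atoms, so
   that [tautology] covers all substitution instances of classical
   tautologies. *)
Fixpoint beval (v : form -> bool) (a : form) : bool :=
  match a with
  | Bot => false
  | Imp a b => beval v a ==> beval v b
  | _ => v a
  end.

Definition tautology (a : form) : Prop := forall v, beval v a.

(* The residuation clause says that PDia is left adjoint to Box. Over the other
   clauses it amounts to normality of Box and of the dual of PDia, together
   with the converse axioms p -> Box (PDia p) and PDia (Box p) -> p. *)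
Record tense_logic (L : set form) : Prop := {
  tl_taut : forall a, tautology a -> L a;
  tl_resid : forall a b, L (Imp (PDia a) b) <-> L (Imp a (Box b));
  tl_mp : forall a b, L a -> L (Imp a b) -> L b;
  tl_subst : forall s a, L a -> L (subst s a) }.

Definition Kt : set form := smallest tense_logic set0.

Definition oplus (L S : set form) : set form := smallest tense_logic (L `|` S).

Definition S4t : set form :=
  oplus Kt [set Imp (Box (Var 0)) (Var 0);
                Imp (Box (Var 0)) (Box (Box (Var 0)))].

Definition NExt (L : set form) : set (set form) :=
  [set M | tense_logic M /\ L `<=` M].

Definition consistent (L : set form) : Prop := ~ L Bot.

Record frame : Type := Frame {
  world : Type;
  acc : world -> world -> Prop;
  world_inh : inhabited world }.

Fixpoint sat (F : frame) (V : nat -> set (world F)) (x : world F) (a : form)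
    : Prop :=
  match a with
  | Var n => V n x
  | Bot => False
  | Imp a b => sat V x a -> sat V x b
  | Box a => forall y, acc x y -> sat V y a
  | PDia a => exists2 y, acc y x & sat V y a
  end.

Definition Log (F : frame) : set form := [set a | forall V (x : world F), sat V x a].

Definition finite_frame (F : frame) : Prop := finite_set [set: world F].

Definition tabular (L : set form) : Prop :=
  exists F : frame, finite_frame F /\ L = Log F.

(* Frames being nonempty, the inconsistent logic is not tabular; it has no
   consistent extension at all, and is excluded here by [consistent L]. *)
Definition pretabular (L : set form) : Prop :=
  [/\ tense_logic L, consistent L, ~ tabular L &
      forall M, NExt L M -> L `<` M -> consistent M -> tabular M].

Definition PTAB (L : set form) : set (set form) := NExt L `&` pretabular.

(* Main.v *)
Require Import Defs.
From Stdlib Require Import ZArith Lia.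
From mathcomp Require Import all_boot.
From mathcomp Require Import boolp classical_sets functions cardinality filter.
From mathcomp Require Import zify.

(* Let L_n be the logic of a finite zigzag one end of which is blown up to an
   infinite cluster. L_n is pretabular: as soon as a valuation is not constant
   on the cluster, every other point is definable by its distance from the
   cluster, so a model of a proper extension of L_n has boundedly many
   distinguishable points.

   A pretabular logic is prime: if it contains the intersection of two logics
   then it contains one of them, since tabular logics are closed under binary
   intersections. Hence the first n logics L_i intersect in a logic with exactly
   n pretabular extensions.

   For the infinite case intersect all L_n. By primeness a pretabular extension
   M other than the L_n contains every formula valid in almost all L_n. If M had
   a theorem refuted on the infinite zigzag Z, the refutation could be copied
   around any cluster with a nonconstant valuation, so in M such clusters do not
   exist and M extends Log Z; copying the refutation around a definable point
   of Z then shows that in a model of M on Z every point is indistinguishable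
   from one nearby on either side, which makes M tabular. Hence M is contained in
   Log Z, and M = Log Z because Log Z is not tabular. *)

Set Implicit Arguments.
Unset Strict Implicit.
Unset Printing Implicit Defensive.

Local Open Scope classical_set_scope.
Local Open Scope card_scope.

(** * Tense logics and Kripke semantics *)

Definition Neg a := Imp a Bot.
Definition And a b := Neg (Imp a (Neg b)).
Definition Or a b := Imp (Neg a) b.
Definition Dia a := Neg (Box (Neg a)).
(** Possibility along accessibility or its converse; iterating it makes bounded undirected distance
    expressible. *)
Definition Tri a := Or (Dia a) (PDia a).

Fixpoint ors (n : nat) (f : nat -> form) : form :=
  if n is n'.+1 then Or (ors n' f) (f n') else Bot.

Ltac taut :=
  let v := fresh "v" in
  move=> v /=;
  repeat (match goal with
          | |- context [beval v ?a] => case: (beval v a)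
          | |- context [v ?a] => case: (v a)
          end => /=); done.

Section TenseLogic.

Variables (L : set form) (HL : tense_logic L).

Lemma tl_mp1 a b : L a -> tautology (Imp a b) -> L b.
Proof. by move=> La t; apply: (tl_mp HL La); exact: (tl_taut HL). Qed.

Lemma tl_mp2 a b c : L a -> L b -> tautology (Imp a (Imp b c)) -> L c.
Proof. by move=> La Lb t; apply: (tl_mp HL Lb); apply: tl_mp1 La t. Qed.

Lemma tl_nec a : L a -> L (Box a).
Proof.
move=> La; have : L (Imp (Imp Bot Bot) (Box a)).
  by apply/(tl_resid HL); apply: tl_mp1 La _; taut.
by move=> /tl_mp1; apply; taut.
Qed.

Lemma tl_neg_past a : L (Neg a) -> L (Neg (PDia a)).
Proof. by move=> La; apply/(tl_resid HL); apply: tl_mp1 La _; taut. Qed.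

Lemma tl_PDia_Box a : L (Imp (PDia (Box a)) a).
Proof. by apply/(tl_resid HL); apply: (tl_taut HL); taut. Qed.

Lemma tl_Box_PDia a : L (Imp a (Box (PDia a))).
Proof. by apply/(tl_resid HL); apply: (tl_taut HL); taut. Qed.

Lemma tl_Box_mono a b : L (Imp a b) -> L (Imp (Box a) (Box b)).
Proof.
move=> Lab; apply/(tl_resid HL).
by apply: (tl_mp2 (tl_PDia_Box a) Lab); taut.
Qed.

Lemma tl_PDia_mono a b : L (Imp a b) -> L (Imp (PDia a) (PDia b)).
Proof.
move=> Lab; apply/(tl_resid HL).
by apply: (tl_mp2 Lab (tl_Box_PDia b)); taut.
Qed.

Lemma tl_neg_Tri_iter n a : L a -> L (Neg (iter n Tri (Neg a))).
Proof.
move=> La; elim: n => [|n IH] /=; first by apply: tl_mp1 La _; taut.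
by apply: (tl_mp2 (tl_nec IH) (tl_neg_past IH)); taut.
Qed.

Lemma tl_ors n f : (forall j, L (Neg (f j))) -> L (Neg (ors n f)).
Proof.
move=> Lf; elim: n => [|n IH] /=; first by apply: (tl_taut HL); taut.
by apply: (tl_mp2 IH (Lf n)); taut.
Qed.

End TenseLogic.

(* The join of [M] and [A] in the lattice of tense logics; as [A] is closed under
   [Box] and the dual of [PDia], no iterated modalities are needed in front of
   [a]. *)
Definition join (M A : set form) : set form :=
  [set c | exists2 a, A a & M (Imp a c)].

Lemma join_tense M A : tense_logic M -> tense_logic A -> tense_logic (join M A).
Proof.
move=> HM HA; split.
- move=> c tc; exists (Imp Bot Bot); first by apply: (tl_taut HA); taut.
  by apply: (tl_mp1 HM (tl_taut HM tc)); taut.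
- move=> b c; split=> -[a Aa Ma].
    (* Residuation will be applied to [And b (Box a)], whose [PDia] yields both [PDia b] and [a]. *)
    exists (Box a); first exact: tl_nec.
    have Pb : M (Imp (PDia (And b (Box a))) (PDia b)).
      by apply: (tl_PDia_mono HM); apply: (tl_taut HM); taut.
    have Pa : M (Imp (PDia (And b (Box a))) (PDia (Box a))).
      by apply: (tl_PDia_mono HM); apply: (tl_taut HM); taut.
    have Pa' : M (Imp (PDia (And b (Box a))) a).
      by apply: (tl_mp2 HM Pa (tl_PDia_Box HM a)); taut.
    have Pc : M (Imp (PDia (And b (Box a))) c).
      apply: (tl_mp HM Pb); apply: (tl_mp2 HM Pa' Ma).
      by taut.
    by apply: (tl_mp1 HM (iffLR (tl_resid HM _ _) Pc)); taut.
  (* Where [a] holds the hypothesis gives [Box c]; where it fails, every successor satisfies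
     [PDia (Neg a)], so the implication is vacuous there. *)
  exists (Neg (PDia (Neg a))).
    by apply: (tl_neg_past HA); apply: (tl_mp1 HA Aa); taut.
  have B1 : M (Imp (Box c) (Box (Imp (Neg (PDia (Neg a))) c))).
    by apply: (tl_Box_mono HM); apply: (tl_taut HM); taut.
  have B2 : M (Imp (Box (PDia (Neg a))) (Box (Imp (Neg (PDia (Neg a))) c))).
    by apply: (tl_Box_mono HM); apply: (tl_taut HM); taut.
  have B3 : M (Imp (And a b) (Box (Imp (Neg (PDia (Neg a))) c))).
    by apply: (tl_mp2 HM Ma B1); taut.
  have B4 : M (Imp (Neg a) (Box (Imp (Neg (PDia (Neg a))) c))).
    by apply: (tl_mp2 HM (tl_Box_PDia HM (Neg a)) B2); taut.
  have /(tl_resid HM) Pc : M (Imp b (Box (Imp (Neg (PDia (Neg a))) c))).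
    by apply: (tl_mp2 HM B3 B4); taut.
  by apply: (tl_mp1 HM Pc); taut.
- move=> b c [a Aa Ma] [a' Aa' Ma']; exists (And a a').
    by apply: (tl_mp2 HA Aa Aa'); taut.
  by apply: (tl_mp2 HM Ma Ma'); taut.
- move=> s b [a Aa Ma]; exists (subst s a); first exact: (tl_subst HA).
  exact: (tl_subst HM s Ma).
Qed.

Lemma sub_join_l M A : tense_logic M -> tense_logic A -> M `<=` join M A.
Proof.
move=> HM HA c Mc; exists (Imp Bot Bot); first by apply: (tl_taut HA); taut.
by apply: (tl_mp1 HM Mc); taut.
Qed.

Lemma sub_join_r M A : tense_logic M -> A `<=` join M A.
Proof. by move=> HM c Ac; exists c => //; apply: (tl_taut HM); taut. Qed.

(** Distributivity: if [a] in [A] and [b] in [B] each yield [c] over [M], so does [Or a b], which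
    lies in both [A] and [B]. *)
Lemma joinI M A B : tense_logic M -> tense_logic A -> tense_logic B ->
  A `&` B `<=` M -> join M A `&` join M B `<=` M.
Proof.
move=> HM HA HB sub c [[a Aa Ma] [b Bb Mb]].
have Mab : M (Or a b).
  by apply: sub; split; [apply: (tl_mp1 HA Aa)|apply: (tl_mp1 HB Bb)]; taut.
by apply: (tl_mp HM Mab); apply: (tl_mp2 HM Ma Mb); taut.
Qed.

Lemma tense_bigcap (I : Type) (P : set I) (L : I -> set form) :
  (forall i, P i -> tense_logic (L i)) -> tense_logic (\bigcap_(i in P) L i).
Proof.
move=> HL; split.
- by move=> a ta i Pi; exact: (tl_taut (HL i Pi)).
- by move=> a b; split=> h i Pi; apply/(tl_resid (HL i Pi)); exact: h.
- by move=> a b ha hab i Pi; apply: (tl_mp (HL i Pi) (ha i Pi)); exact: hab.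
- by move=> s a ha i Pi; apply: (tl_subst (HL i Pi)); exact: ha.
Qed.

Section Semantics.

Variables (F : frame) (V : nat -> set (world F)).

Lemma sat_Imp x a b : sat V x (Imp a b) = (sat V x a -> sat V x b).
Proof. by []. Qed.

Lemma sat_Neg x a : sat V x (Neg a) <-> ~ sat V x a.
Proof. by []. Qed.

Lemma sat_And x a b : sat V x (And a b) <-> sat V x a /\ sat V x b.
Proof.
split=> [h|[ha hb] h]; last exact: h.
by split; apply: contrapT => n; apply: h => h1 h2; apply: n.
Qed.

Lemma sat_Or x a b : sat V x (Or a b) <-> sat V x a \/ sat V x b.
Proof.
split=> [h|[ha na|hb _ //]]; last by case: na.
by have [ha|na] := pselect (sat V x a); [left|right; exact: h].
Qed.

Lemma sat_Dia x a : sat V x (Dia a) <-> exists2 y, acc x y & sat V y a.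
Proof.
split=> [h|[y xy ya] h]; last exact: (h y xy ya).
by apply: contrapT => n; apply: h => y xy ya; apply: n; exists y.
Qed.

Lemma sat_ors x n f : sat V x (ors n f) <-> exists2 j, j < n & sat V x (f j).
Proof.
elim: n => [|n IH]; first by split=> [|[]].
rewrite -/(Or _ _) sat_Or IH; split=> [[[j jn fj]|fn]|[j]].
- by exists j => //; exact: ltnW.
- by exists n.
- rewrite ltnS leq_eqVlt => /orP[/eqP->|jn fj]; first by right.
  by left; exists j.
Qed.

Lemma sat_subst s x a :
  sat V x (subst s a) <-> sat (fun q => [set y | sat V y (s q)]) x a.
Proof.
elim: a x => [p||a IHa b IHb|a IH|a IH] x //=.
- by rewrite IHa IHb.
- by split=> h y xy; apply/IH; exact: h.
- by split=> -[y xy ya]; exists y => //; apply/IH.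
Qed.

Lemma sat_taut x a : tautology a -> sat V x a.
Proof.
move=> /(_ (fun b => `[<sat V x b>])).
suff -> : beval (fun b => `[<sat V x b>]) a = `[<sat V x a>] by move/asboolP.
elim: a => //= [|a -> b ->]; first by apply/esym/asboolP.
by rewrite asbool_imply.
Qed.

End Semantics.

Lemma Log_tense F : tense_logic (Log F).
Proof.
split.
- by move=> a ta V x; exact: sat_taut.
- move=> a b; split=> h V x.
    by move=> xa y xy; apply: (h V y); exists x.
  by case=> y yx ya; exact: (h V y ya x yx).
- by move=> a b ha hab V x; apply: hab; exact: ha.
- by move=> s a ha V x; apply/sat_subst; exact: ha.
Qed.

Lemma Log_consistent F : consistent (Log F).
Proof. by case: (world_inh F) => x /(_ (fun=> set0) x). Qed.

Definition sum_acc (F G : frame) (x y : world F + world G) :=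
  match x, y with
  | inl x, inl y => acc x y
  | inr x, inr y => acc x y
  | _, _ => False
  end.

Definition sum_frame (F G : frame) : frame :=
  Frame (@sum_acc F G)
    (match world_inh F with inhabits x => inhabits (inl x) end).

(** * Bisimulations and primeness *)

Fixpoint mdepth (a : form) : nat :=
  match a with
  | Var _ | Bot => 0
  | Imp a b => maxn (mdepth a) (mdepth b)
  | Box a | PDia a => (mdepth a).+1
  end.

Fixpoint nvars (a : form) : nat :=
  match a with
  | Var p => p.+1
  | Bot => 0
  | Imp a b => maxn (nvars a) (nvars b)
  | Box a | PDia a => nvars a
  end.

Section Bisimulation.

Variables (F G : frame) (V : nat -> set (world F)) (U : nat -> set (world G)).

(** Each modality spends one unit of the index, so a relation matching only a bounded neighbourhood
    and the first [k] variables suffices. *)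
Lemma nbisim k (B : nat -> world F -> world G -> Prop) :
  (forall n x y p, B n x y -> p < k -> V p x <-> U p y) ->
  (forall n x y x', B n.+1 x y -> acc x x' -> exists2 y', acc y y' & B n x' y') ->
  (forall n x y y', B n.+1 x y -> acc y y' -> exists2 x', acc x x' & B n x' y') ->
  (forall n x y x', B n.+1 x y -> acc x' x -> exists2 y', acc y' y & B n x' y') ->
  (forall n x y y', B n.+1 x y -> acc y' y -> exists2 x', acc x' x & B n x' y') ->
  forall a n x y, nvars a <= k -> mdepth a <= n -> B n x y ->
    sat V x a <-> sat U y a.
Proof.
move=> Batom Bff Bfb Bpf Bpb.
elim=> [p||a IHa b IHb|a IH|a IH] n x y /=.
- by move=> pk _ Bxy; exact: Batom Bxy pk.
- by [].
- rewrite !geq_max => /andP[ka kb] /andP[da db] Bxy.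
  by rewrite (IHa n x y ka da Bxy) (IHb n x y kb db Bxy).
- case: n => // n ka da Bxy; split=> h z.
    by move=> /(Bfb _ _ _ _ Bxy)[x' xx' B']; apply/(IH n x' z); auto.
  by move=> /(Bff _ _ _ _ Bxy)[y' yy' B']; apply/(IH n z y'); auto.
- case: n => // n ka da Bxy; split=> -[z].
    by move=> /(Bpf _ _ _ _ Bxy)[y' yy' B'] h; exists y' => //; apply/(IH n z y').
  by move=> /(Bpb _ _ _ _ Bxy)[x' xx' B'] h; exists x' => //; apply/(IH n x' z).
Qed.

Lemma pmorphism (f : world F -> world G) :
  (forall p x, V p x <-> U p (f x)) ->
  (forall x x', acc x x' -> acc (f x) (f x')) ->
  (forall x y, acc (f x) y -> exists2 x', acc x x' & f x' = y) ->
  (forall x y, acc y (f x) -> exists2 x', acc x' x & f x' = y) ->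
  forall a x, sat V x a <-> sat U (f x) a.
Proof.
move=> fV facc ff fp a x.
apply: (@nbisim (nvars a) (fun _ x y => f x = y)) (leqnn _) (leqnn _) erefl.
- by move=> _ {}x _ p <- _.
- by move=> _ {}x _ x' <- xx'; exists (f x') => //; exact: facc.
- by move=> _ {}x _ y' <- /ff[x' xx' fx']; exists x'.
- by move=> _ {}x _ x' <- xx'; exists (f x') => //; exact: facc.
- by move=> _ {}x _ y' <- /fp[x' xx' fx']; exists x'.
Qed.

End Bisimulation.

Lemma Log_sum F G : Log (sum_frame F G) = Log F `&` Log G.
Proof.
have sl (V : nat -> set (world (sum_frame F G))) x a :
    sat (F := F) (fun p => [set y | V p (inl y)]) x a <-> sat V (inl x) a.
  by apply: pmorphism => // {}x [y|y] //= xy; exists y.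
have sr (V : nat -> set (world (sum_frame F G))) x a :
    sat (F := G) (fun p => [set y | V p (inr y)]) x a <-> sat V (inr x) a.
  by apply: pmorphism => // {}x [y|y] //= xy; exists y.
apply/seteqP; split=> [a h|a [hF hG] V [x|x]]; [|exact/sl|exact/sr].
have [x0] := world_inh F; have [y0] := world_inh G.
split=> V x.
  have /sl := h (fun p u => if u is inl x then V p x else False) (inl x).
  exact.
have /sr := h (fun p u => if u is inr x then V p x else False) (inr x).
exact.
Qed.

Lemma tabularI L M : tabular L -> tabular M -> tabular (L `&` M).
Proof.
move=> [F [finF ->]] [G [finG ->]]; exists (sum_frame F G).
split; last by rewrite Log_sum.
rewrite /finite_frame.
have -> : [set: world (sum_frame F G)] = inl @` setT `|` inr @` setT.
  by apply/seteqP; split=> // -[x|x] _; [left|right]; exists x.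
by rewrite finite_setU; split; exact: finite_image.
Qed.

Lemma tabular_seq (T : eqType) (G : T -> set form) (s : seq T) :
  s != [::] -> (forall t, t \in s -> tabular (G t)) ->
  tabular [set a | forall t, t \in s -> G t a].
Proof.
elim: s => // t [|t' s] IH _ tabG.
  have -> : [set a | forall u, u \in [:: t] -> G u a] = G t.
    apply/seteqP; split=> a /=; first by apply; rewrite inE.
    by move=> h u; rewrite inE => /eqP->.
  by apply: tabG; rewrite inE.
have -> : [set a | forall u, u \in t :: t' :: s -> G u a] =
    G t `&` [set a | forall u, u \in t' :: s -> G u a].
  apply/seteqP; split=> a /=.
    by move=> h; split=> [|u us]; apply: h; rewrite inE ?eqxx// us orbT.
  by move=> [ht h] u; rewrite inE => /orP[/eqP->|/h].
apply: tabularI; first by apply: tabG; rewrite mem_head.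
by apply: IH => // u us; apply: tabG; rewrite inE us orbT.
Qed.

Lemma pretabular_prime M A B :
  pretabular M -> tense_logic A -> tense_logic B ->
  A `&` B `<=` M -> A `<=` M \/ B `<=` M.
Proof.
move=> [HM consM ntabM preM] HA HB sub.
apply: contrapT => /not_orP[nA nB].
have jprop C : tense_logic C -> ~ C `<=` M ->
    [/\ NExt M (join M C), M `<` join M C & ~ join M C `<=` M].
  move=> HC nC.
  have njM : ~ join M C `<=` M.
    by move=> h; apply: nC; apply: subset_trans h; exact: sub_join_r.
  have MjM := sub_join_l HM HC.
  by split=> //; split=> //; exact: join_tense.
have [NA MA nAM] := jprop _ HA nA; have [NB MB nBM] := jprop _ HB nB.
have subI := joinI HM HA HB sub.
have incons C c : tense_logic C -> ~ consistent C -> C c.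
  move=> HC /contrapT CBot; apply: (tl_mp1 HC CBot); taut.
(* An inconsistent join contains everything, so by [subI] the other join would lie in [M]. *)
have [consA|nconsA] := pselect (consistent (join M A)); last first.
  by apply: nBM => c Bc; apply: subI; split=> //; apply: incons => //; case: NA.
have [consB|nconsB] := pselect (consistent (join M B)); last first.
  by apply: nAM => c Ac; apply: subI; split=> //; apply: incons => //; case: NB.
apply: ntabM; suff -> : M = join M A `&` join M B.
  by apply: tabularI; apply: preM.
apply/seteqP; split=> // c Mc.
by split; [case: NA|case: NB] => _; apply.
Qed.

(** The remainder [R] absorbs one logic at a time, which reduces each step of the induction to
    primeness for two factors. *)
Lemma pretabular_bigcap M (L : nat -> set form) R n :
  pretabular M -> (forall i, tense_logic (L i)) -> tense_logic R ->
  (\bigcap_(i in `I_n) L i) `&` R `<=` M ->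
  (exists2 i, i < n & L i `<=` M) \/ R `<=` M.
Proof.
move=> preM HL; elim: n R => [|n IH] R HR sub.
  by right=> a Ra; apply: sub; split.
have HRn : tense_logic (L n `&` R).
  have -> : L n `&` R = \bigcap_(b in [set: bool]) (if b then L n else R).
    by apply/seteqP; split=> [a [] ? ? []|a h] //; split; [exact: (h true)|exact: (h false)].
  by apply: tense_bigcap => -[].
have [|[i i_n LiM]|] := IH (L n `&` R) HRn.
- move=> a [h [Ln Ra]]; apply: sub; split=> // i /=.
  by rewrite ltnS leq_eqVlt => /orP[/eqP->//|/h].
- by left; exists i => //; exact: ltnW.
by move=> /(pretabular_prime preM (HL n) HR)[LnM|]; [left; exists n|right].
Qed.

Lemma pretabular_eq L M :
  pretabular L -> pretabular M -> L `<=` M -> L = M.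
Proof.
move=> [HL _ _ preL] [HM consM ntabM _] LM; apply/seteqP; split=> //.
apply: contrapT => nML; apply: ntabM; apply: preL => //; split=> //.
Qed.

(** * Tabularity from bounded models *)

Definition indist (F : frame) (V : nat -> set (world F)) x y :=
  forall a, sat V x a <-> sat V y a.

Definition gsat (M : set form) (F : frame) (V : nat -> set (world F)) :=
  forall x, M `<=` sat V x.

Definition definable (F : frame) (V : nat -> set (world F)) (X : set (world F)) :=
  exists a, forall x, sat V x a <-> X x.

Definition covers T (E : T -> T -> Prop) n (e : nat -> T) :=
  forall x, exists2 j, j < n & E x (e j).

Definition ands n f := Neg (ors n (fun j => Neg (f j))).

Lemma sat_ands F (V : nat -> set (world F)) x n f :
  sat V x (ands n f) <-> forall j, j < n -> sat V x (f j).
Proof.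
rewrite /ands sat_Neg sat_ors; split=> [h j jn|h [j jn]]; last first.
  by rewrite sat_Neg; apply; exact: h.
by apply: contrapT => nf; apply: h; exists j.
Qed.

Lemma min_cover T (E : T -> T -> Prop) n (e : nat -> T) :
  (forall x y z, E x y -> E y z -> E x z) -> covers E n e ->
  exists m (g : nat -> T), [/\ m <= n, covers E m g &
    forall i j, i < m -> j < m -> E (g i) (g j) -> i = j].
Proof.
move=> Etr; elim: n e => [|n IH] e cov; first by exists 0, e.
have [inj|] := pselect (forall i j, i < n.+1 -> j < n.+1 -> E (e i) (e j) -> i = j).
  by exists n.+1, e.
move=> /existsNP[i /existsNP[j /not_implyP[i_n /not_implyP[jn /not_implyP[Eij ij]]]]].
have [|m [g [mn covg injg]]] := IH (e \o bump i); last first.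
  by exists m, g; split=> //; exact: leqW.
have unb k : k < n.+1 -> k <> i -> exists2 k', k' < n & bump i k' = k.
  move=> kn /eqP ki; exists (unbump i k); last by rewrite unbumpKcond (negPf ki).
  by rewrite /unbump; case: ltngtP ki => //=; lia.
move=> x; have [k kn xk] := cov x.
have [ki|ki] := eqVneq k i; last first.
  by have [k' k'n k'k] := unb k kn (elimN eqP ki); exists k'; rewrite //= k'k.
have [k' k'n k'j] := unb j jn (fun h => ij (esym h)).
by exists k'; rewrite //= k'j; apply: Etr Eij; rewrite -ki.
Qed.

Section Equivalence.

Variables (F : frame) (V : nat -> set (world F)).

Lemma indist_refl x : indist V x x. Proof. by []. Qed.

Lemma indist_sym x y : indist V x y -> indist V y x.
Proof. by move=> h a; rewrite h. Qed.

Lemma indist_trans x y z : indist V x y -> indist V y z -> indist V x z.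
Proof. by move=> h k a; rewrite h. Qed.

Lemma indistN x y : ~ indist V x y -> exists a, sat V x a /\ ~ sat V y a.
Proof.
move=> /existsNP[a]; have [xa|xa] := pselect (sat V x a).
  by move=> h; exists a; split=> // ya; apply: h.
move=> h; exists (Neg a); split; first exact.
by rewrite sat_Neg => ya; apply: h; split=> // /ya.
Qed.

Lemma gsat_definable M U : tense_logic M -> gsat M V ->
  (forall p, definable V (U p)) -> gsat M U.
Proof.
move=> HM gM /choice[s sU] x a Ma.
have -> : U = fun q => [set y | sat V y (s q)].
  by apply/funext => q; apply/seteqP; split=> y /sU.
by apply/sat_subst; apply: gM; exact: tl_subst.
Qed.

Section Cover.

Variables (n : nat) (e : nat -> world F).
Hypothesis cov : covers (indist V) n e.

(** A representative is singled out by the finite conjunction of formulas separating it from the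
    others, and [X] is the disjunction over the representatives inside it. *)
Lemma cover_definable (X : set (world F)) :
  (forall x y, indist V x y -> X x -> X y) -> definable V X.
Proof.
move=> invX.
have /choice[f fP] (ij : nat * nat) : exists a, ~ indist V (e ij.1) (e ij.2) ->
    sat V (e ij.1) a /\ ~ sat V (e ij.2) a.
  have [E|/indistN[a]] := pselect (indist V (e ij.1) (e ij.2)); first by exists Bot.
  by exists a.
exists (ors n (fun i => if `[<X (e i)>] then
  ands n (fun j => if `[<indist V (e i) (e j)>] then Neg Bot else f (i, j))
  else Bot)) => x.
rewrite sat_ors; split=> [[i i_n]|Xx].
  case: asboolP => // Xi /sat_ands h; have [j jn xj] := cov x.
  apply: invX Xi; apply: indist_trans (indist_sym xj).
  apply: contrapT => nij; have [_] := fP (i, j) nij; apply; apply/xj.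
  by have := h j jn; case: asboolP.
have [i i_n xi] := cov x; exists i => //.
case: asboolP => [_|]; last by move=> /(_ (invX _ _ xi Xx)).
apply/sat_ands => j jn; case: asboolP => [_|nij]; first exact.
by apply/xi; have [] := fP (i, j) nij.
Qed.

(** The class of [x'] is defined by some [a], and [Dia a] transfers from [x] to [y]. Thus
    indistinguishability is a bisimulation once it has finitely many classes. *)
Lemma indist_forth x y x' : indist V x y -> acc x x' ->
  exists2 y', acc y y' & indist V x' y'.
Proof.
move=> xy xx'.
have [|a aP] := @cover_definable [set z | indist V x' z].
  by move=> u v uv h; exact: indist_trans uv.
have /xy/sat_Dia[y' yy' /aP] : sat V x (Dia a); last by exists y'.
by apply/sat_Dia; exists x' => //; apply/aP.
Qed.

Lemma indist_back x y x' : indist V x y -> acc x' x ->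
  exists2 y', acc y' y & indist V x' y'.
Proof.
move=> xy xx'.
have [|a aP] := @cover_definable [set z | indist V x' z].
  by move=> u v uv h; exact: indist_trans uv.
have /xy[y' yy' /aP] : sat V x (PDia a); last by exists y'.
by exists x' => //; apply/aP.
Qed.

End Cover.

End Equivalence.

(** In this encoding the frames on [m.+1] points with [m < b] form a finite type, so they can be
    enumerated. *)
Definition fin_frame b (t : {m : 'I_b & {ffun 'I_m.+1 * 'I_m.+1 -> bool}}) : frame :=
  Frame (fun i j => tagged t (i, j)) (inhabits ord0).

Lemma fin_frame_quotient b M (F : frame) (V : nat -> set (world F)) x phi n e :
  tense_logic M -> n <= b -> covers (indist V) n e -> gsat M V ->
  ~ sat V x phi -> exists t, M `<=` Log (@fin_frame b t) /\ ~ Log (fin_frame t) phi.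
Proof.
move=> HM nb cov gM nphi.
have [m [g [mn covg injg]]] := min_cover (@indist_trans _ V) cov.
case: m mn covg injg => [|m] mn covg injg; first by have [] := covg x.
have /choice[f fP] : forall y, exists j : 'I_m.+1, indist V y (g j).
  by move=> y; have [j jm yj] := covg y; exists (Ordinal jm).
have feq y (j : 'I_m.+1) : indist V y (g j) -> f y = j.
  move=> yj; apply: val_inj; apply: (injg _ _ (ltn_ord _) (ltn_ord _)).
  exact: indist_trans (indist_sym (fP y)) yj.
pose t : {m : 'I_b & {ffun 'I_m.+1 * 'I_m.+1 -> bool}} :=
  Tagged (fun m : 'I_b => {ffun 'I_m.+1 * 'I_m.+1 -> bool})
  (i := Ordinal (leq_trans mn nb))
  [ffun ij : 'I_m.+1 * 'I_m.+1 =>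
     `[<exists2 y, acc (g ij.1) y & indist V y (g ij.2)>]].
have taccP (i j : world (fin_frame t)) :
    acc i j <-> exists2 y, acc (g i) y & indist V y (g j).
  by rewrite /= ffunE; split=> /asboolP.
have fmor (W : nat -> set (world (fin_frame t))) (V' : nat -> set (world F)) :
    (forall p y, V' p y <-> W p (f y)) ->
    forall a y, sat V' y a <-> sat W (f y : world (fin_frame t)) a.
  move=> VW; apply: pmorphism => // [y y' yy'|y j /taccP[z fz zj]|y j /taccP[z jz zy]].
  - apply/taccP; have [z fz y'z] := indist_forth covg (fP y) yy'.
    by exists z => //; apply: indist_trans (fP y'); exact: indist_sym.
  - have [y' yy' zy'] := indist_forth covg (indist_sym (fP y)) fz.
    by exists y' => //; apply: feq; apply: indist_trans zj; exact: indist_sym.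
  - have [y' yy' jy'] := indist_back covg (indist_trans zy (indist_sym (fP y))) jz.
    by exists y' => //; apply: feq; exact: indist_sym.
exists t; split; last first.
  pose W p (j : world (fin_frame t)) := V p (g (j : 'I_m.+1)).
  move=> /(_ W (f x : world (fin_frame t))) h; apply: nphi.
  exact/(fmor W V (fun p y => fP y (Var p)))/h.
move=> a Ma W j.
(* A valuation of the quotient pulls back to unions of indistinguishability classes; these are
   definable in [V], so substitution preserves the truth of [M]. *)
have gW : gsat M (fun p y => W p (f y)).
  apply: (gsat_definable HM gM) => p; apply: (cover_definable covg) => y z yz.
  suff -> : f y = f z by [].
  by apply: feq; apply: indist_trans yz (fP z).
have <- : f (g (j : 'I_m.+1)) = j by apply: feq.
exact/(fmor W (fun p y => W p (f y)) (fun _ _ => iff_refl _))/gW.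
Qed.

(** Passing to quotients, [M] is the intersection of the logics of those among the finitely many
    frames on at most [b] points that validate it. *)
Lemma tabular_bounded b M : tense_logic M -> consistent M ->
  (forall phi, ~ M phi -> exists F (V : nat -> set (world F)) x n e,
     [/\ n <= b, covers (indist V) n e, gsat M V & ~ sat V x phi]) ->
  tabular M.
Proof.
move=> HM consM bd.
have quo phi : ~ M phi -> exists t : {m : 'I_b & {ffun 'I_m.+1 * 'I_m.+1 -> bool}},
    M `<=` Log (fin_frame t) /\ ~ Log (fin_frame t) phi.
  move=> /bd[F [V [x [n [e [nb cov gM nphi]]]]]].
  exact: fin_frame_quotient cov gM nphi.
pose s := [seq t <- enum {: {m : 'I_b & {ffun 'I_m.+1 * 'I_m.+1 -> bool}}} |
             `[<M `<=` Log (fin_frame t)>]].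
have sP t : t \in s <-> M `<=` Log (fin_frame t).
  by rewrite mem_filter mem_enum andbT; split=> /asboolP.
have -> : M = [set a | forall t, t \in s -> Log (fin_frame t) a].
  apply/seteqP; split=> [a Ma t /sP|a h]; first exact.
  by apply: contrapT => /quo[t [/sP ts]]; apply; exact: h.
apply: tabular_seq => [|t _].
  have [t [/sP ts _]] := quo _ consM.
  by apply/eqP => s0; rewrite s0 in ts.
by exists (fin_frame t); split=> //; exact: finite_finset.
Qed.

(** * Nontabularity and compactness *)

Fixpoint reach (F : frame) n (x y : world F) : Prop :=
  if n is n'.+1 then exists2 z, (acc x z \/ acc z x) & reach n' z y else x = y.

Lemma sat_Tri F (V : nat -> set (world F)) x a :
  sat V x (Tri a) <-> exists2 y, (acc x y \/ acc y x) & sat V y a.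
Proof.
rewrite sat_Or sat_Dia; split=> [[[y xy ya]|[y yx ya]]|[y [xy|yx] ya]].
- by exists y => //; left.
- by exists y => //; right.
- by left; exists y.
- by right; exists y.
Qed.

Lemma sat_Tri_iter F (V : nat -> set (world F)) n x a :
  sat V x (iter n Tri a) <-> exists2 y, reach n x y & sat V y a.
Proof.
elim: n x => [|n IH] x; first by split=> [|[y <-]//]; exists x.
rewrite iterS sat_Tri; split=> [[z xz /IH[y zy ya]]|[y [z xz zy] ya]].
  by exists y => //; exists z.
by exists z => //; apply/IH; exists y.
Qed.

Lemma gsat_reach M F (V : nat -> set (world F)) x :
  tense_logic M -> (forall y, exists n, reach n x y) -> M `<=` sat V x -> gsat M V.
Proof.
move=> HM conn Mx y a Ma; have [n xy] := conn y.
apply: contrapT => nya; have := Mx _ (tl_neg_Tri_iter HM n Ma).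
by rewrite sat_Neg; apply; apply/sat_Tri_iter; exists y.
Qed.

Lemma Log_not_tabular F :
  (forall n, exists m x (e : nat -> world F),
     (forall i j, i < n -> j < n -> e i = e j -> i = j) /\
     (forall j, j < n -> reach m x (e j))) ->
  ~ tabular (Log F).
Proof.
move=> big [G [/finite_setP[n cardG] FG]].
have [m [x [e [inj re]]]] := big n.+1.
(* [c] denies that [n.+1] points are within reach, the [j]-th satisfying [Var j] and no earlier
   variable. Such points are distinct, so [c] is valid on the [n] points of [G]. *)
pose c := Neg (ands n.+1 (fun j => iter m Tri (And (Var j) (Neg (ors j Var))))).
have : Log G c.
  move=> V y; rewrite sat_Neg sat_ands => h.
  have /choice[g gP] j : exists z, j < n.+1 ->
      sat V z (Var j) /\ forall i, i < j -> ~ sat V z (Var i).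
    case: (ltnP j n.+1) => [/h/sat_Tri_iter[z _ /sat_And[zj nz]]|_]; last by exists y.
    exists z => _; split=> // i ij zi; move: nz; rewrite sat_Neg; apply.
    by apply/sat_ors; exists i.
  have ginj : {in `I_n.+1 &, injective g}.
    move=> i j; rewrite !inE /= => /gP[gi ni] /gP[gj nj] gij.
    apply/eqP; case: ltngtP => // ij.
      by have [] := nj _ ij; rewrite -gij.
    by have [] := ni _ ij; rewrite gij.
  have := subset_card_le (subsetT (g @` `I_n.+1)).
  rewrite (card_le_eql (inj_card_eq ginj)) (card_le_eqr cardG) card_le_II.
  by rewrite ltnn.
rewrite -FG => /(_ (fun p => [set y | y = e p]) x).
rewrite sat_Neg; apply; apply/sat_ands => j jn; apply/sat_Tri_iter.
exists (e j); first exact: re.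
apply/sat_And; split=> //; rewrite sat_Neg => /sat_ors[i ij /= ji].
have : i = j by apply: inj => //; lia.
lia.
Qed.

(** * Ultrafilter limits of valuations *)

Lemma ultra_pick (I : Type) (U : set_system I) n (P : nat -> set I) :
  UltraFilter U -> U [set i | exists2 j, j < n & P j i] ->
  exists2 j, j < n & U (P j).
Proof.
move=> HU; elim: n => [|n IH] Un.
  by have [i []] := filter_ex Un.
have [Pn|nPn] := in_ultra_setVsetC (P n) HU; first by exists n.
have [|j jn Pj] := IH; last by exists j => //; exact: leqW.
apply: filterS (filterI Un nPn) => i [[j]].
by rewrite ltnS leq_eqVlt => /orP[/eqP->//|jn Pj _]; exists j.
Qed.

Lemma ultraC (I : Type) (U : set_system I) (A : set I) :
  UltraFilter U -> U (~` A) <-> ~ U A.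
Proof.
move=> HU; split=> [UnA UA|nA].
  by have [i []] := filter_ex (filterI UA UnA).
by have [] := in_ultra_setVsetC A HU.
Qed.

Definition image_finite (F : frame) := forall x : world F, exists n (e : nat -> world F),
  forall y, acc x y \/ acc y x -> exists2 j, j < n & y = e j.

(** An analogue of the theorem of Łoś on a fixed frame, with only the valuations varying. Image
    finiteness allows one modal witness to be chosen for almost all indices. *)
Lemma ultra_sat (I : Type) (U : set_system I) F (V : I -> nat -> set (world F)) x a :
  UltraFilter U -> image_finite F ->
  sat (fun p => [set y | U [set i | V i p y]]) x a <-> U [set i | sat (V i) x a].
Proof.
move=> HU imF; elim: a x => [p||a IHa b IHb|a IH|a IH] x //=.
- by split=> // U0; have [i []] := filter_ex U0.
- rewrite IHa IHb; split=> [h|UI Ua].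
    have [Ua|Una] := in_ultra_setVsetC [set i | sat (V i) x a] HU.
      by apply: filterS (h Ua) => i /= bi _.
    by apply: filterS Una => i /= na /na.
  by apply: filterS (filterI UI Ua) => i /= []; apply.
- split=> [h|h y xy]; last by apply/IH; apply: filterS h => i; exact.
  apply: contrapT => /(iffRL (ultraC _ HU)) nU; have [n [e eP]] := imF x.
  have [|j jn] := @ultra_pick _ _ n
      (fun j => [set i | acc x (e j) /\ ~ sat (V i) (e j) a]) HU.
    apply: filterS nU => i /existsNP[y /not_implyP[xy nya]].
    by have [j jn yj] := eP y (or_introl xy); exists j => //; rewrite -yj.
  move=> Uj; have [i [xj _]] := filter_ex Uj.
  have [i' [ja []//]] := filter_ex (filterI (iffLR (IH _) (h _ xj)) Uj).
- split=> [[y yx /IH]|h]; first by apply: filterS => i ya; exists y.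
  have [n [e eP]] := imF x.
  have [|j jn] := @ultra_pick _ _ n
      (fun j => [set i | acc (e j) x /\ sat (V i) (e j) a]) HU.
    apply: filterS h => i [y yx ya].
    by have [j jn yj] := eP y (or_intror yx); exists j => //; rewrite -yj.
  move=> Uj; have [i [xj _]] := filter_ex Uj; exists (e j) => //.
  by apply/IH; apply: filterS Uj => {}i [].
Qed.

Lemma compactness F (X : nat -> world F) N M phi :
  image_finite F -> tense_logic M ->
  (forall psi, M psi -> exists V j, [/\ j < N, sat V (X j) psi & ~ sat V (X j) phi]) ->
  exists V j, [/\ j < N, M `<=` sat V (X j) & ~ sat V (X j) phi].
Proof.
move=> imF HM ref.
have /choice[Vj VjP] psi : exists Vj : (nat -> set (world F)) * nat, M psi ->
    [/\ Vj.2 < N, sat Vj.1 (X Vj.2) psi & ~ sat Vj.1 (X Vj.2) phi].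
  have [/ref[V [j h]]|] := pselect (M psi); first by exists (V, j).
  by exists (fun=> set0, 0).
(* The limit is taken over theorems of [M], along an ultrafilter containing for each [mu] the
   theorems at least as strong as [mu]; conjunction makes these sets a filter base. *)
pose E mu := [set psi | M psi /\ tautology (Imp psi mu)].
pose FF : set_system form := [set A | exists2 mu, M mu & E mu `<=` A].
have top : M (Neg Bot) by apply: (tl_taut HM); taut.
have propFF : ProperFilter FF.
  split.
    by move=> [mu Mmu /(_ mu)]; apply; split=> //; taut.
  split.
  - by exists (Neg Bot).
  - move=> A B [mu Mmu muA] [nu Mnu nuB]; exists (And mu nu).
      by apply: (tl_mp2 HM Mmu Mnu); taut.
    move=> psi [Mpsi t]; split; [apply: muA|apply: nuB]; split=> // v;
      move: (t v) => /=; by case: (beval v psi); case: (beval v mu); case: (beval v nu).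
  - by move=> A B AB [mu Mmu muA]; exists mu => //; exact: subset_trans AB.
have [U [HU FU]] := ultraFilterLemma propFF.
have UE mu : M mu -> U (E mu) by move=> Mmu; apply: FU; exists mu.
have [|j jN Uj] := @ultra_pick _ U N (fun j => [set psi | (Vj psi).2 = j]) HU.
  by apply: filterS (UE _ top) => psi [/VjP[h _ _] _]; exists (Vj psi).2.
exists (fun p => [set y | U [set psi | (Vj psi).1 p y]]), j; split=> //.
  move=> mu Mmu; apply/(ultra_sat (fun psi => (Vj psi).1)) => //.
  apply: filterS (filterI Uj (UE _ Mmu)) => psi [<- [/VjP[_ h _] t]].
  exact: (sat_taut _ _ t h).
move=> /(ultra_sat (fun psi => (Vj psi).1)) => /(_ imF) h.
have [psi [[/= jE [/VjP[_ _ nphi] _]] ]] :=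
  filter_ex (filterI (filterI Uj (UE _ top)) h).
by rewrite -jE => /nphi.
Qed.

(** * Zigzags and fences *)

Ltac zlia := zify; Z.to_euclidean_division_equations; lia.

(** Even integers see both neighbours, odd ones see only themselves. *)
Definition zacc (a b : Z) : Prop :=
  (a = b \/ a mod 2 = 0 /\ (b = a + 1 \/ b = a - 1))%Z.

Lemma zaccW a b : zacc a b -> (Z.abs (a - b) <= 1)%Z.
Proof. rewrite /zacc; lia. Qed.

Lemma zacc_near a b : zacc a b \/ zacc b a <-> (Z.abs (a - b) <= 1)%Z.
Proof. rewrite /zacc; zlia. Qed.

Lemma zacc_trans a b c : zacc a b -> zacc b c -> zacc a c.
Proof. rewrite /zacc; zlia. Qed.

Lemma zacc_move a b a' b' : zacc a b -> (a mod 2 = a' mod 2)%Z ->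
  (Z.abs (a' - b') <= 1)%Z -> (a = b -> a' = b') -> zacc a' b'.
Proof. rewrite /zacc; lia. Qed.

(** [pos] may fail to be injective: points sharing a position form a cluster. *)
Definition line W (pos : W -> Z) (w : inhabited W) : frame :=
  Frame (fun x y => zacc (pos x) (pos y)) w.

Definition zline : frame := line id (inhabits 0%Z).

(* A zigzag of [n.+2] points whose point [0] is replaced by the cluster [D]. *)
Definition fence_pos D n (x : D + 'I_n.+1) : Z :=
  match x with inl _ => 0%Z | inr j => Z.of_nat j.+1 end.

Definition fence D (d : D) n : frame := line (@fence_pos D n) (inhabits (inl d)).

Lemma S4t_line W (pos : W -> Z) w : NExt S4t (Log (line pos w)).
Proof.
split; first exact: Log_tense.
apply: smallest_sub; first exact: Log_tense.
move=> a [Ka|[]->] V x /=.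
- move: a Ka V x; apply: smallest_sub => //; exact: Log_tense.
- by apply; left.
- by move=> h y xy z yz; apply: h; exact: zacc_trans yz.
Qed.

Section Line.

Variables (W : Type) (pos : W -> Z) (w : inhabited W).
Let F := line pos w.

Definition interval_image :=
  forall x y c, (pos x <= c <= pos y)%Z -> exists z, pos z = c.

Lemma reach_line n (x y : world F) : interval_image ->
  (Z.abs (pos x - pos y) <= Z.of_nat n.+1)%Z -> reach n.+1 x y.
Proof.
move=> conv; elim: n x => [|n IH] x h; first by exists y => //; apply/zacc_near.
have [xy|xy] := boolP (Z.abs (pos x - pos y) <=? 1)%Z.
  exists y; first by apply/zacc_near; lia.
  by apply: IH; lia.
have [z [xz zy]] : exists z,
    (Z.abs (pos x - pos z) <= 1 /\ Z.abs (pos z - pos y) <= Z.of_nat n.+1)%Z.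
  have [lt|lt] := boolP (pos x <? pos y)%Z.
    by have [z zE] := conv x y (pos x + 1)%Z ltac:(lia); exists z; lia.
  by have [z zE] := conv y x (pos x - 1)%Z ltac:(lia); exists z; lia.
by exists z; [exact/zacc_near|exact: IH].
Qed.

Lemma sat_Tri_line (V : nat -> set (world F)) x a :
  sat V x (Tri a) <-> exists2 y : W, (Z.abs (pos x - pos y) <= 1)%Z & sat V y a.
Proof.
by rewrite sat_Tri; split=> -[y xy ya]; exists y => //; apply/zacc_near.
Qed.

(** [Tri] is reflexive on a line, so [iter m Tri a] describes the ball of radius [m] around [a], and
    this formula the sphere of radius [j.+1]. *)
Definition level a j := And (iter j.+1 Tri a) (Neg (iter j Tri a)).

(** Copies [U] to the right of an origin: [e j] is meant to define the position [j.+1] steps away,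
    and [d] is the integer corresponding to the origin. *)
Definition transplant (U : nat -> set Z) (d : Z) N (e : nat -> form) q : form :=
  ors N (fun j => if `[<U q (d + Z.of_nat j.+1)%Z>] then e j else Bot).

(** Truth of [chi] at [z0] depends only on the integers within [mdepth chi]. Moving [z0] to [y0 + t]
    keeps this ball among the positions defined by the [e j], and equal parity preserves the
    direction of arrows. *)
Lemma sat_transplant (V : nat -> set (world F)) (U : nat -> set (world zline))
    (z0 y0 t : Z) N e chi x :
  (forall (x : W) j, j < N -> (1 <= pos x - y0 <= Z.of_nat N)%Z ->
     sat (F := F) V x (e j) <-> (pos x - y0 = Z.of_nat j.+1)%Z) ->
  (forall c, (1 <= c <= Z.of_nat N)%Z -> exists x, pos x = (y0 + c)%Z) ->
  (Z.of_nat (mdepth chi) < t)%Z -> (t + Z.of_nat (mdepth chi) <= Z.of_nat N)%Z ->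
  ((y0 + t) mod 2 = z0 mod 2)%Z -> pos x = (y0 + t)%Z ->
  sat V x (subst (transplant U (z0 - t) N e) chi) <-> sat U z0 chi.
Proof.
move=> eP surj rt tN par xt; rewrite sat_subst.
pose B n (x : world F) (z : world zline) :=
  ((pos x - (y0 + t) = z - z0) /\
   (Z.abs (z - z0) + Z.of_nat n <= Z.of_nat (mdepth chi)))%Z.
have near z : (Z.abs (z - z0) <= Z.of_nat (mdepth chi))%Z ->
    exists x, (pos x - (y0 + t) = z - z0)%Z.
  move=> h; have [|u uE] := surj (z - z0 + t)%Z; first lia.
  by exists u; lia.
have step n (u : world F) (u' : world F) z : B n.+1 u z ->
    (Z.abs (pos u - pos u') <= 1)%Z -> B n u' (z + (pos u' - pos u))%Z.
  by rewrite /B; lia.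
have step' n u z z' : B n.+1 u z -> (Z.abs (z - z') <= 1)%Z ->
    exists2 u', B n u' z' & (pos u' - pos u = z' - z)%Z.
  move=> Buz zz'; have [|u' u'E] := near z'; first by move: Buz; rewrite /B; lia.
  by exists u'; move: Buz; rewrite /B; lia.
have par' n u z : B n u z -> (pos u mod 2 = z mod 2)%Z.
  by rewrite /B; zlia.
apply: (@nbisim F zline _ _ (nvars chi) B _ _ _ _ _ chi (mdepth chi)) => //; last by split; lia.
- move=> n u z p [uz zn] _; rewrite /= sat_ors; split=> [[j jN]|Uz].
    case: asboolP => // Uj /(eP _ _ jN) uj; suff -> : z = (z0 - t + Z.of_nat j.+1)%Z by [].
    by lia.
  have jN : Z.to_nat (z - z0 + t - 1) < N by lia.
  exists (Z.to_nat (z - z0 + t - 1)) => //.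
  case: asboolP => [_|]; first by apply/(eP _ _ jN); lia.
  by have -> : (z0 - t + Z.of_nat (Z.to_nat (z - z0 + t - 1)).+1 = z)%Z by lia.
- move=> n u z u' Buz uu'; exists (z + (pos u' - pos u))%Z.
    by apply: (zacc_move uu' (par' _ _ _ Buz) _ _); move: (zaccW uu') => /=; lia.
  by apply: step Buz _; exact: zaccW.
- move=> n u z z' Buz zz'; have [u' Bu'z' E] := step' _ _ _ _ Buz (zaccW zz').
  exists u' => //; apply: (zacc_move zz' (esym (par' _ _ _ Buz)) _ _);
  by move: (zaccW zz') => /=; lia.
- move=> n u z u' Buz uu'; have Buz' := step _ _ u' _ Buz.
  have h : B n u' (z + (pos u' - pos u))%Z by apply: Buz'; have := zaccW uu'; lia.
  exists (z + (pos u' - pos u))%Z => //.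
  by apply: (zacc_move uu' (par' _ _ _ h) _ _); move: (zaccW uu') => /=; lia.
- move=> n u z z' Buz zz'.
  have [|u' Bu'z' E] := step' _ _ _ z' Buz; first by have := zaccW zz' => /=; lia.
  exists u' => //; apply: (zacc_move zz' (esym (par' _ _ _ Bu'z')) _ _);
  by move: (zaccW zz') => /=; lia.
Qed.

End Line.

Section Fence.

Variables (D : Type) (d0 : D) (n : nat).
Let F := fence d0 n.
Local Notation pos := (@fence_pos D n).

Lemma fence_pos_range x : (0 <= pos x <= Z.of_nat n.+1)%Z.
Proof. by case: x => [d|j] /=; [|have := ltn_ord j]; lia. Qed.

Lemma fence_pos_surj c : (0 <= c <= Z.of_nat n.+1)%Z -> exists x, pos x = c.
Proof.
move=> h; have [c0|c0] := boolP (c =? 0)%Z; first by exists (inl d0) => /=; lia.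
have jn : Z.to_nat (c - 1) < n.+1 by lia.
by exists (inr (Ordinal jn)) => /=; lia.
Qed.

Lemma fence_pos_inj x y :
  pos x = pos y -> x = y \/ exists d d', x = inl d /\ y = inl d'.
Proof.
case: x y => [d|j] [d'|k] /=; [|lia|lia|].
  by right; exists d, d'.
by move=> jk; left; congr inr; apply: val_inj => /=; lia.
Qed.

Lemma fence_interval : interval_image pos.
Proof.
move=> x y c h; apply: fence_pos_surj.
by have := fence_pos_range x; have := fence_pos_range y; lia.
Qed.

Lemma fence_connected (x y : world F) : exists m, reach m x y.
Proof.
exists n.+2; apply: reach_line; first exact: fence_interval.
by have := fence_pos_range x; have := fence_pos_range y; lia.
Qed.

(* Off the cluster the order has depth two, so no point starts a chain along
   which [p] changes its value twice. *)
Definition mix p :=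
  Or (And (Var p) (Dia (And (Neg (Var p)) (Dia (Var p)))))
     (And (Neg (Var p)) (Dia (And (Var p) (Dia (Neg (Var p)))))).

Lemma sat_mix (V : nat -> set (world F)) (x : world F) p :
  sat V x (mix p) <->
  exists d d', x = inl d /\ (V p (inl d) <-> ~ V p (inl d')).
Proof.
have peak x1 x2 x3 (P : set (world F)) : acc (f := F) x1 x2 -> acc (f := F) x2 x3 ->
    P x1 -> ~ P x2 -> P x3 -> exists d d', x1 = inl d /\ x2 = inl d'.
  move=> a12 a23 P1 P2 P3.
  have [/fence_pos_inj[E|//]|n12] := pselect (pos x1 = pos x2).
    by case: P2; rewrite -E.
  (* A point seen from a different position is odd and sees only its own position, whereas the
     cluster sits at the even position 0. *)
  have /fence_pos_inj[E|[d [d' [E _]]]] : pos x2 = pos x3.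
  - by move: a12 a23 n12; rewrite /= /zacc; zlia.
  - by case: P2; rewrite E.
  - by move: a12 n12; rewrite E /= /zacc; zlia.
rewrite sat_Or !sat_And !sat_Dia; split.
  move=> [[px [y xy /sat_And[py /sat_Dia[z yz pz]]]]|
          [px [y xy /sat_And[py /sat_Dia[z yz pz]]]]].
    have [d [d' [E E']]] := peak x y z (V p) xy yz px py pz.
    by exists d, d'; subst x y; split.
  have nn : ~ (~` V p) y by apply.
  have [d [d' [E E']]] := peak x y z (~` V p) xy yz px nn pz.
  by exists d, d'; subst x y; split=> //; split=> [/px|/(_ py)].
move=> [d [d' [-> dd']]]; have [pd|pd] := pselect (V p (inl d)).
  left; split=> //; exists (inl d'); first by left.
  by rewrite sat_And; split; [exact/dd'|apply/sat_Dia; exists (inl d); [left|]].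
right; split=> //; exists (inl d'); first by left.
rewrite sat_And; split; last by apply/sat_Dia; exists (inl d); [left|].
by apply: contrapT => h; apply: pd; apply/dd'.
Qed.

Lemma sat_mix_pos (V : nat -> set (world F)) p d d' :
  (V p (inl d) <-> ~ V p (inl d')) ->
  forall x : world F, sat V x (mix p) <-> pos x = 0%Z.
Proof.
move=> dd' x.
have differs u : exists u', inl u = inl u :> world F /\ (V p (inl u) <-> ~ V p (inl u')).
  by have [pu|pu] := pselect (V p (inl u)); have [pd|pd] := pselect (V p (inl d));
    [exists d'|exists d|exists d|exists d']; tauto.
rewrite sat_mix; split=> [[u [_ [-> _]]] //|].
move=> /(@fence_pos_inj x (inl d0))[->|[u [_ [-> _]]]].
  by exists d0; apply: differs.
by exists u; apply: differs.
Qed.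

Lemma sat_level_fence (V : nat -> set (world F)) a j (x : world F) :
  (forall x : world F, sat V x a <-> pos x = 0%Z) ->
  sat V x (level a j) <-> pos x = Z.of_nat j.+1.
Proof.
move=> aP.
have ballP m (y : world F) : sat V y (iter m Tri a) <-> (pos y <= Z.of_nat m)%Z.
  elim: m y => [|m IH] y; first by rewrite aP; have := fence_pos_range y; lia.
  rewrite iterS sat_Tri_line; split=> [[z yz /IH]|ym]; first lia.
  have [|z zE] := @fence_pos_surj (Z.max 0 (pos y - 1)).
    by have := fence_pos_range y; lia.
  exists z; first by have := fence_pos_range y; lia.
  by apply/IH; lia.
by rewrite sat_And sat_Neg !ballP; have := fence_pos_range x; lia.
Qed.

End Fence.

(** * Extensions of the logic of the infinite zigzag *)

Lemma parity_above (r : nat) (z : Z) :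
  exists t : nat, r < t <= r.+2 /\ (Z.of_nat t mod 2 = z mod 2)%Z.
Proof.
have [h|h] := boolP ((Z.of_nat r.+1) mod 2 =? z mod 2)%Z.
  by exists r.+1; split; lia.
by exists r.+2; split; zlia.
Qed.

Definition fence_logic n := Log (fence 0 n).

Definition fence_tail n0 : set form :=
  \bigcap_(n in [set n | n0 <= n]) fence_logic n.

(** In a long fence on whose cluster [p] varies, the levels over [mix p] define positions, so the
    refutation of [chi] is copied at distance [t]. The resulting implication lies in a tail, hence
    in [M], and its conclusion contradicts an instance of [chi]. *)
Lemma no_mix M chi p : tense_logic M -> (forall n0, fence_tail n0 `<=` M) ->
  M chi -> ~ Log zline chi -> M (Neg (mix p)).
Proof.
move=> HM tail Mchi /existsNP[U /existsNP[z0 nchi]].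
have [t [rt tpar]] := parity_above (mdepth chi) z0.
pose s := transplant U (z0 - Z.of_nat t) (t + mdepth chi) (level (mix p)).
suff Mt : M (Imp (mix p) (iter t Tri (Neg (subst s chi)))).
  apply: (tl_mp2 HM Mt (tl_neg_Tri_iter HM t (tl_subst HM s Mchi))); taut.
apply: (tail (t + mdepth chi)) => n /= nN V x; rewrite sat_Imp => /sat_mix[d [d' [xd dd']]].
have mixP := sat_mix_pos dd'.
have [|y yt] := @fence_pos_surj nat 0 n (Z.of_nat t); first by lia.
apply/sat_Tri_iter; exists y.
  case: t rt yt {tpar s nN} => // t rt yt.
  by apply: reach_line; [exact: (fence_interval 0)|rewrite yt xd /=; lia].
suff E : sat V y (subst s chi) <-> sat U z0 chi by move=> /E.
apply: (@sat_transplant _ _ _ V U z0 0%Z) => //; try lia.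
- by move=> u j _ hu; rewrite Z.sub_0_r; exact: sat_level_fence.
- by move=> c cN; apply: (fence_pos_surj 0); lia.
Qed.

(** * Folding the integers onto a segment by reflections in the multiples of [n] *)

Definition fold (n z : Z) : Z := Z.min (z mod (2 * n)) (2 * n - z mod (2 * n)).

Lemma foldP n z : (0 < n)%Z -> exists k d,
  [/\ z = 2 * (n * k) + d, Z.abs d <= n & fold n z = Z.abs d]%Z.
Proof.
move=> n0; rewrite /fold.
have := Z.div_mod z (2 * n) ltac:(lia).
have := Z.mod_pos_bound z (2 * n) ltac:(lia).
move: (z mod _)%Z (z / _)%Z => m q mb zE.
have [mn|mn] := boolP (m <=? n)%Z.
  by exists q, m; split; lia.
by exists (q + 1)%Z, (m - 2 * n)%Z; split; lia.
Qed.

Lemma fold_unique n k d : (0 < n -> Z.abs d <= n ->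
  fold n (2 * (n * k) + d) = Z.abs d)%Z.
Proof.
move=> n0 dn; rewrite /fold.
have [d0|d0] := boolP (0 <=? d)%Z.
  rewrite -(Z.mod_unique_pos (2 * (n * k) + d) (2 * n) k d); lia.
rewrite -(Z.mod_unique_pos (2 * (n * k) + d) (2 * n) (k - 1) (2 * n + d)); lia.
Qed.

Lemma fold_range n z : (0 < n -> 0 <= fold n z <= n)%Z.
Proof. by move=> /(foldP z)[k [d [_ ? ->]]]; lia. Qed.

Lemma fold_parity n z : (0 < n -> fold n z mod 2 = z mod 2)%Z.
Proof.
move=> /(foldP z)[k [d [-> _ ->]]]; move: (n * k)%Z => c; zlia.
Qed.

Lemma fold_id n z : (0 < n -> 0 <= z <= n -> fold n z = z)%Z.
Proof.
move=> n0 zn; have -> : (z = 2 * (n * 0) + z)%Z by lia.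
by rewrite fold_unique; lia.
Qed.

Lemma fold_near n z z' : (0 < n -> Z.abs (z - z') <= 1 ->
  Z.abs (fold n z - fold n z') <= 1)%Z.
Proof.
move=> n0 zz'; have [k [d [zE dn ->]]] := foldP z n0.
have z'E : (z' = 2 * (n * k) + (d + (z' - z)))%Z by lia.
have [d'n|d'n] := boolP (Z.abs (d + (z' - z)) <=? n)%Z.
  by rewrite z'E fold_unique; lia.
have [dpos|dpos] := boolP (0 <? d)%Z.
  have -> : (z' = 2 * (n * (k + 1)) + (d + (z' - z) - 2 * n))%Z by lia.
  by rewrite fold_unique; lia.
have -> : (z' = 2 * (n * (k - 1)) + (d + (z' - z) + 2 * n))%Z by lia.
by rewrite fold_unique; lia.
Qed.

(** The lift keeps [k] and the sign of [d], staying on the branch of the folding through [z]. The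
    last clause serves [zacc_move], which transfers equality of endpoints. *)
Lemma fold_lift n z b : (0 < n -> 0 <= b <= n -> Z.abs (fold n z - b) <= 1 ->
  exists z', [/\ Z.abs (z - z') <= 1, fold n z' = b & (fold n z = b -> z' = z)])%Z.
Proof.
move=> n0 bn; have [k [d [zE dn fE]]] := foldP z n0; rewrite fE => near.
have [dpos|dneg] := boolP (0 <=? d)%Z.
  by exists (2 * (n * k) + b)%Z; split; [lia|rewrite fold_unique; lia|lia].
by exists (2 * (n * k) - b)%Z; split; [lia| |lia];
   rewrite -Z.add_opp_r fold_unique; lia.
Qed.

(** If no variable of [phi] varies on the cluster within the depth of [phi], the fence looks there
    like a finite zigzag, an image of [zline] under [fold]; a refutation of [phi] would pull back to
    [zline]. *)
Lemma sub_zline_of_no_mix M : tense_logic M -> (forall n0, fence_tail n0 `<=` M) ->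
  (forall p, M (Neg (mix p))) -> Log zline `<=` M.
Proof.
move=> HM tail nomix phi phiZ.
pose r := mdepth phi; pose k := nvars phi.
suff Mt : M (Imp (Neg (iter r.+1 Tri (Neg (Neg (ors k mix))))) phi).
  exact: (tl_mp HM (tl_neg_Tri_iter HM r.+1 (tl_ors HM k nomix)) Mt).
apply: (tail 0) => n _ V x.
rewrite sat_Imp sat_Neg => noc.
pose len := Z.of_nat n.+1; have len0 : (0 < len)%Z by rewrite /len; lia.
(* [w] picks a point at each position of the fence, [inl 0] standing for the whole cluster. *)
have /choice[w wP] c : exists y : nat + 'I_n.+1,
    ((0 <= c <= len)%Z -> fence_pos y = c) /\ (c = 0%Z -> y = inl 0).
  have [->|c0] := pselect (c = 0%Z); first by exists (inl 0).
  have [cr|ncr] := pselect (0 <= c <= len)%Z; last by exists (inl 0).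
  by have [y yc] := fence_pos_surj 0 cr; exists y.
pose U q z := V q (w (fold len z)).
pose B m (y : world (fence 0 n)) (z : world zline) :=
  (fence_pos y = fold len z /\
   Z.abs (fence_pos y - fence_pos x) + Z.of_nat m <= Z.of_nat r)%Z.
have fr z := @fold_range len z len0.
have pr (y : nat + 'I_n.+1) := fence_pos_range y.
have par m y z : B m y z -> (fence_pos y mod 2 = z mod 2)%Z.
  by move=> [-> _]; exact: fold_parity.
have step m y z y' : B m.+1 y z -> (Z.abs (fence_pos y - fence_pos y') <= 1)%Z ->
    exists z', [/\ B m y' z', (Z.abs (z - z') <= 1)%Z &
                   fence_pos y = fence_pos y' -> z' = z].
  move=> [yz ym] yy'.
  have [|z' [zz' z'E z'z]] := @fold_lift len z (fence_pos y') len0 (pr y').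
    by rewrite -yz.
  by exists z'; split=> //; [split=> //; lia|rewrite yz].
have step' m y z z' : B m.+1 y z -> (Z.abs (z - z') <= 1)%Z ->
    exists y', [/\ B m y' z', (Z.abs (fence_pos y - fence_pos y') <= 1)%Z &
                   z = z' -> fence_pos y = fence_pos y'].
  move=> [yz ym] zz'; have [y' y'E] := fence_pos_surj 0 (fr z').
  have near := fold_near len0 zz'.
  exists y'; split; [by split=> //; lia|by lia|].
  by move=> zz; rewrite yz y'E zz.
have [z1 xz1] : exists z, B r x z.
  by exists (fence_pos x); split; [rewrite fold_id; have := pr x; lia|lia].
suff E : sat V x phi <-> sat (F := zline) U z1 phi by apply/E; exact: phiZ.
apply: (@nbisim (fence 0 n) zline V U k B _ _ _ _ _ phi r x z1) => //.
- move=> m y z' p [yz ym] pk; rewrite /U /= -yz.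
  have [wpos w0] := wP (fence_pos y).
  case: (fence_pos_inj (wpos (pr y))) => [-> //|[d [d' [wd yd]]]].
  have y0 : fence_pos y = 0%Z by rewrite yd.
  have nmix : ~ sat (F := fence 0 n) V y (mix p).
    move=> ymix; apply: noc; apply/sat_Tri_iter; exists y.
      by apply: reach_line; [exact: (fence_interval 0)|lia].
    by rewrite !sat_Neg; apply; apply/sat_ors; exists p.
  rewrite (w0 y0) yd; apply: contrapT => npq; apply: nmix; apply/sat_mix.
  by exists d', 0; split=> //; have [pd|pd] := pselect (V p (inl d')); tauto.
- move=> m y z y' Byz yy'; have [z' [By'z' zz' zE]] := step _ _ _ _ Byz (zaccW yy').
  by exists z' => //; apply: zacc_move yy' (par _ _ _ Byz) zz' _ => /zE.
- move=> m y z z' Byz zz'; have [y' [By'z' yy' yE]] := step' _ _ _ _ Byz (zaccW zz').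
  by exists y' => //; apply: zacc_move zz' (esym (par _ _ _ Byz)) yy' yE.
- move=> m y z y' Byz yy'.
  have [|z' [By'z' zz' zE]] := step _ _ _ y' Byz; first by have := zaccW yy' => /=; lia.
  exists z' => //; apply: zacc_move yy' (par _ _ _ By'z') _ _; first lia.
  by move/esym/zE.
- move=> m y z z' Byz zz'.
  have [|y' [By'z' yy' yE]] := step' _ _ _ z' Byz; first by have := zaccW zz' => /=; lia.
  exists y' => //; apply: zacc_move zz' (esym (par _ _ _ By'z')) _ _; first lia.
  by move/esym/yE.
Qed.

Lemma zline_interval : interval_image (@id Z).
Proof. by move=> _ _ c _; exists c. Qed.

Lemma zline_not_tabular : ~ tabular (Log zline).
Proof.
apply: Log_not_tabular => n; exists n.+1, (0%Z : world zline), Z.of_nat; split.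
  by move=> i j _ _; lia.
by move=> j jn; apply: reach_line; [exact: zline_interval|rewrite /=; lia].
Qed.

(** Otherwise some [y] is separated from the next [T] points by one formula; the levels over it
    define positions to its right, where the refutation of [chi] is copied. The bound is uniform in
    [V]. *)
Lemma right_return M chi (U : nat -> set (world zline)) z0 :
  tense_logic M -> M chi -> ~ sat U z0 chi ->
  exists T : nat, forall V : nat -> set (world zline), gsat M V ->
    forall y, exists s, (0 < s <= Z.of_nat T)%Z /\ indist V (y : world zline) (y + s)%Z.
Proof.
move=> HM Mchi nchi; pose N := (mdepth chi).*2.+2.
(* The copy fits into [N] positions since [t <= mdepth chi + 2]; the other [N] leave room for the
   balls used in [level], as [alpha] is controlled only up to [y + N.*2]. *)
exists N.*2 => V gM y; apply: contrapT => /forallNP noret.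
have /choice[f fP] j : exists a, j < N.*2 ->
    sat V (y : world zline) a /\ ~ sat V (y + Z.of_nat j.+1 : world zline)%Z a.
  have [jT|jT] := boolP (j < N.*2); last by exists Bot.
  have /indistN[a aP] : ~ indist V (y : world zline) (y + Z.of_nat j.+1)%Z.
    by move=> yj; apply: (noret (Z.of_nat j.+1)); split=> //; lia.
  by exists a.
pose alpha := ands N.*2 f.
have alphaP x : (y <= x <= y + Z.of_nat N.*2)%Z ->
    sat V (x : world zline) alpha <-> x = y.
  move=> xb; split=> [/sat_ands xa|->]; last by apply/sat_ands => j /fP[].
  apply: contrapT => xy; have jT : Z.to_nat (x - y - 1) < N.*2 by lia.
  have [_] := fP _ jT; apply.
  suff -> : (y + Z.of_nat (Z.to_nat (x - y - 1)).+1 = x)%Z by exact: xa.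
  by lia.
have ballP m x : (y <= x)%Z -> (x + Z.of_nat m <= y + Z.of_nat N.*2)%Z ->
    sat V (x : world zline) (iter m Tri alpha) <-> (x <= y + Z.of_nat m)%Z.
  elim: m x => [|m IH] x yx xm; first by rewrite alphaP; lia.
  rewrite iterS sat_Tri_line; split=> [[x' xx' x'a]|xym].
    have [//|lt] := boolP (x <=? y + Z.of_nat m.+1)%Z; first lia.
    by move: x'a; rewrite IH; lia.
  exists (Z.max y (x - 1))%Z; first lia.
  by apply/IH; lia.
have [t [rt tpar]] := parity_above (mdepth chi) (z0 - y).
apply: nchi; pose s := transplant U (z0 - Z.of_nat t) N (level alpha).
suff <- : sat V (y + Z.of_nat t : world zline)%Z (subst s chi) <-> sat U z0 chi.
  by apply: gM; exact: tl_subst.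
apply: (@sat_transplant _ _ _ V U z0 y) => //; try lia.
- move=> u j jN uN; rewrite sat_And sat_Neg !ballP; lia.
- by move=> c _; exists (y + c)%Z.
- by zlia.
Qed.

Lemma zline_pmorphism (V : nat -> set (world zline)) (f : Z -> Z) :
  (forall a b, zacc a b -> zacc (f a) (f b)) ->
  (forall a b, zacc (f a) (f b) -> zacc a b) -> (forall b, exists a, f a = b) ->
  forall a (x : world zline),
    sat (F := zline) (fun p => [set y | V p (f y)]) x a <-> sat V (f x : world zline) a.
Proof.
move=> fh fr fs a x; apply: pmorphism => //.
  by move=> {}x y xy; have [x' yE] := fs y; exists x' => //; apply: fr; rewrite yE.
by move=> {}x y xy; have [x' yE] := fs y; exists x' => //; apply: fr; rewrite yE.
Qed.

Lemma zline_ext_tabular M chi : tense_logic M -> consistent M ->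
  Log zline `<=` M -> M chi -> ~ Log zline chi -> tabular M.
Proof.
move=> HM consM ZM Mchi /existsNP[U /existsNP[z0 nchi]].
have [T ret] := right_return HM Mchi nchi.
apply: (tabular_bounded (b := T.+1)) => // phi nphi.
have imF : image_finite zline.
  move=> x; exists 3, (fun j => x + Z.of_nat j - 1)%Z => y /zacc_near /= xy.
  by exists (Z.to_nat (y - x + 1)); lia.
(* Even translations are automorphisms of the zigzag, so the refuting point can be moved to 0 or
   1. *)
have [|V [j [_ Mj phij]]] := @compactness zline Z.of_nat 2 M phi imF HM.
  move=> psi Mpsi; have : ~ Log zline (Imp psi phi).
    by move=> /ZM /(tl_mp HM Mpsi).
  move=> /existsNP[V /existsNP[z /not_implyP[zpsi zphi]]].
  pose c := (2 * (z / 2))%Z.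
  have zE : (Z.of_nat (Z.to_nat (z mod 2)) + c = z)%Z by rewrite /c; zlia.
  have shift a (x : world zline) :
      sat (F := zline) (fun p => [set y : Z | V p (y + c)%Z]) x a <->
      sat V (x + c : world zline)%Z a.
    apply: (zline_pmorphism V (f := fun y => (y + c)%Z)) => [u v|u v|b].
    - by rewrite /zacc /c; zlia.
    - by rewrite /zacc /c; zlia.
    - by exists (b - c)%Z; lia.
  exists (fun p => [set y : Z | V p (y + c)%Z]), (Z.to_nat (z mod 2)).
  by split; [zlia|apply/shift; rewrite zE|move=> /shift; rewrite zE].
have gM : gsat M V.
  apply: (gsat_reach HM _ Mj) => y.
  exists (Z.to_nat (Z.abs (Z.of_nat j - y))).+1.
  by apply: reach_line; [exact: zline_interval|lia].
(* Reflection at 0 is an automorphism and turns returns to the right into returns to the left. *)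
have retl (y : Z) : exists s, (0 < s <= Z.of_nat T)%Z /\ indist V (y : world zline) (y - s)%Z.
  have opp a (x : world zline) :
      sat (F := zline) (fun p => [set y : Z | V p (- y)%Z]) x a <->
      sat V (- x : world zline)%Z a.
    apply: (zline_pmorphism V (f := Z.opp)) => [u v|u v|b].
    - by rewrite /zacc; zlia.
    - by rewrite /zacc; zlia.
    - by exists (- b)%Z; lia.
  have [|s [sT h]] := ret (fun p => [set y : Z | V p (- y)%Z]) _ (- y)%Z.
    by move=> x a /gM Ma; apply/opp.
  exists s; split=> // a; move: (h a); rewrite !opp.
  by rewrite Z.opp_involutive (_ : - (- y + s) = y - s)%Z //; lia.
exists zline, V, (Z.of_nat j : world zline), T.+1, Z.of_nat; split=> // x.
suff [y yT xy] : exists2 y, (0 <= y <= Z.of_nat T)%Z & indist V x (y : world zline).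
  by exists (Z.to_nat y); [lia|rewrite Z2Nat.id; [exact: xy|lia]].
(* [m] bounds how far [x] lies outside the interval from 0 to [T]; returns have length at most [T],
   so they never overshoot it. *)
have [m xm] : exists m : nat, (- Z.of_nat m <= x <= Z.of_nat T + Z.of_nat m)%Z.
  by exists (Z.to_nat (Z.abs x)); lia.
elim: m x xm => [|m IH] x xm; first by exists x => //; lia.
have [x0|x0] := boolP (x <? 0)%Z.
  have [s [sT xs]] := ret V gM x.
  have [|y yT ys] := IH (x + s)%Z; first by lia.
  by exists y => //; exact: indist_trans ys.
have [xT|xT] := boolP (Z.of_nat T <? x)%Z.
  have [s [sT xs]] := retl x.
  have [|y yT ys] := IH (x - s)%Z; first by lia.
  by exists y => //; exact: indist_trans ys.
by exists x => //; lia.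
Qed.

(** * Extensions of the logic of a fence *)

Lemma fence_not_tabular n : ~ tabular (fence_logic n).
Proof.
apply: Log_not_tabular => m; exists 1, (inl 0 : world (fence 0 n)), inl; split.
  by move=> i j _ _ [].
by move=> j _; apply: reach_line; [exact: (fence_interval 0)|].
Qed.

(** The formula used denies a point at distance exactly [i.+2] from a cluster on which variable 0
    varies: the fence of index [i] ends at [i.+1], longer ones reach further. *)
Lemma fence_logic_inj : injective fence_logic.
Proof.
have lt_neq i j : i < j -> fence_logic i <> fence_logic j.
  move=> ij E.
  have : fence_logic i (Neg (level (mix 0) i.+1)).
    move=> V x; rewrite sat_Neg => lx.
    have [/sat_Tri_iter[y _ /sat_mix[d [d' [_ dd']]]] _] := iffLR (sat_And _ _ _ _) lx.
    move: lx; rewrite (sat_level_fence _ _ (sat_mix_pos dd')).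
    by have := fence_pos_range x; lia.
  rewrite E => h; have [|x xE] := @fence_pos_surj nat 0 j (Z.of_nat i.+2); first lia.
  have := h (fun _ => [set y : world (fence 0 j) | y = inl 0]) x.
  rewrite sat_Neg; apply.
  have mixed : inl 0 = inl 0 :> world (fence 0 j) <-> inl 1 <> inl 0 :> world (fence 0 j).
    by split.
  exact/(sat_level_fence _ _ (@sat_mix_pos nat 0 j (fun _ => [set y | y = inl 0]) 0 0 1 mixed)).
move=> i j E; apply/eqP; case: ltngtP => // /lt_neq; first by case.
by move=> /(_ (esym E)).
Qed.

(** * Replacing the infinite cluster by a finite cluster of types *)

Definition trunc k p := if p < k then Var p else Bot.

Lemma nvars_trunc k a : nvars (subst (trunc k) a) <= k.
Proof.
elim: a => //= [p|a IHa b IHb]; last by rewrite geq_max IHa.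
by rewrite /trunc; case: ifP.
Qed.

Notation types k := {ffun 'I_k -> bool}.

Definition type0 k : types k := [ffun => false].

(** Cluster points agreeing on the first [k] variables are merged into their Boolean type. [U] makes
    all later variables false, so truncation changes nothing there. *)
Lemma fence_types k n (V : nat -> set (world (fence 0 n))) x :
  exists (U : nat -> set (world (fence (type0 k) n))) y,
    (forall a, nvars a <= k -> sat V x a <-> sat U y a) /\
    (forall a z, sat U z (subst (trunc k) a) <-> sat U z a).
Proof.
pose tau (u : nat) : types k := [ffun p : 'I_k => `[<V p (inl u)>]].
have tauP u u' : tau u = tau u' <->
    forall p, p < k -> V p (inl u) <-> V p (inl u').
  split=> [/ffunP E p pk|E].
    by have := E (Ordinal pk); rewrite /tau !ffunE => h;
      split=> /asboolP; [rewrite h|rewrite -h] => /asboolP.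
  by apply/ffunP => p; rewrite /tau !ffunE; apply: asbool_equiv_eq; exact: E.
(* A type that no cluster point realises is sent to an arbitrary point and merely duplicates its
   values. *)
have /choice[nu nuP] (d : types k) : exists u : nat, (exists u', tau u' = d) -> tau u = d.
  have [[u ud]|] := pselect (exists u, tau u = d); first by exists u.
  by exists 0.
pose back (y : world (fence (type0 k) n)) : world (fence 0 n) :=
  match y with inl d => inl (nu d) | inr j => inr j end.
pose U p := [set y | p < k /\ V p (back y)].
pose B (m : nat) (x : world (fence 0 n)) (y : world (fence (type0 k) n)) :=
  fence_pos x = fence_pos y /\ forall p, p < k -> V p x <-> U p y.
have Bl m x' : exists y, B m x' y.
  case: x' => [u|j]; last by exists (inr j); split=> // p pk; split=> [|[]].
  exists (inl (tau u)); split=> // p pk.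
  have /tauP h : tau (nu (tau u)) = tau u by apply: nuP; exists u.
  by rewrite -(h p pk); split=> [|[]].
have Br m y : exists x', B m x' y.
  exists (back y); split; first by case: y.
  by move=> p pk; split=> [|[]].
have [y xy] := Bl 0 x.
exists U, y; split=> [a ak|a z].
  apply: (@nbisim (fence 0 n) (fence (type0 k) n) V U k B _ _ _ _ _ a (mdepth a) x y) => //.
  - by move=> m u v p [_ h] /h.
  - move=> m u v u' [uv _] uu'; have [v' [uv' h]] := Bl m u'; exists v' => //.
    by move: uu'; rewrite /= uv uv'.
  - move=> m u v v' [uv _] vv'; have [u' [uv' h]] := Br m v'; exists u' => //.
    by move: vv'; rewrite /= uv uv'.
  - move=> m u v u' [uv _] uu'; have [v' [uv' h]] := Bl m u'; exists v' => //.
    by move: uu'; rewrite /= uv uv'.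
  - move=> m u v v' [uv _] vv'; have [u' [uv' h]] := Br m v'; exists u' => //.
    by move: vv'; rewrite /= uv uv'.
rewrite sat_subst; suff -> : (fun q => [set y | sat U y (trunc k q)]) = U by [].
apply/funext => q; apply/seteqP; rewrite /trunc.
by split=> v /=; case: ifP => // qk []; rewrite qk.
Qed.

Section Cluster.

Variables (D : finType) (d0 : D) (n : nat) (V : nat -> set (world (fence d0 n))).

Lemma indist_cluster (x y : world (fence d0 n)) :
  fence_pos x = fence_pos y -> (forall p, V p x <-> V p y) -> indist V x y.
Proof.
move=> xy h a.
pose B (m : nat) (x y : world (fence d0 n)) :=
  fence_pos x = fence_pos y /\ forall p, V p x <-> V p y.
apply: (@nbisim (fence d0 n) (fence d0 n) V V (nvars a) B _ _ _ _ _ a (mdepth a) x y) => //.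
- by move=> m u v p [_ uv] _; exact: uv.
- by move=> m u v u' [uv _] uu'; exists u' => //; move: uu'; rewrite /= uv.
- by move=> m u v v' [uv _] vv'; exists v' => //; move: vv'; rewrite /= uv.
- by move=> m u v u' [uv _] uu'; exists u' => //; move: uu'; rewrite /= uv.
- by move=> m u v v' [uv _] vv'; exists v' => //; move: vv'; rewrite /= uv.
Qed.

Lemma fence_covers : exists N (e : nat -> world (fence d0 n)), covers eq N e.
Proof.
exists #|{: D + 'I_n.+1}|, (nth (inl d0) (enum {: D + 'I_n.+1})) => x.
exists (index x (enum {: D + 'I_n.+1})); first by rewrite cardE index_mem mem_enum.
by rewrite nth_index // mem_enum.
Qed.

(* The fence maps onto the one with cluster [D'] by a p-morphism sending [h d] to
   [d] whose fibres are definable in [V]. *)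
Lemma gsat_cluster (D' : finType) (d1 d2 : D') (h : D' -> D) M
    (U : nat -> set (world (fence d1 n))) :
  tense_logic M -> gsat M V -> d1 != d2 ->
  (forall d d', indist V (inl (h d) : world (fence d0 n)) (inl (h d')) -> d = d') ->
  gsat M U.
Proof.
move=> HM gM d12 hinj.
(* A variable separating [h d1] from [h d2] exists, as they would otherwise be indistinguishable;
   then [mix p] defines the cluster, and its levels all other positions. *)
have [p pE] : exists p, V p (inl (h d1)) <-> ~ V p (inl (h d2)).
  apply: contrapT => /forallNP same; apply/negP: d12; apply/negPn/eqP.
  apply: hinj; apply: indist_cluster => // p.
  apply: contrapT => npp; apply: (same p).
  by have [?|?] := pselect (V p (inl (h d1))); tauto.
have posE (x y : world (fence d0 n)) : indist V x y -> fence_pos x = fence_pos y.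
  have mixP := sat_mix_pos pE.
  move=> xy; have [x0|x0] := boolP (fence_pos x =? 0)%Z.
    have /mixP/xy/mixP : fence_pos x = 0%Z by lia.
    by lia.
  have lE : fence_pos x = Z.of_nat (Z.to_nat (fence_pos x - 1)).+1.
    by have := fence_pos_range x; lia.
  by move/(sat_level_fence _ _ mixP)/xy/(sat_level_fence _ _ mixP): (lE); rewrite -lE.
(* Cluster points indistinguishable from no [h d] go to the default [d1]. *)
pose g c := odflt d1 [pick d | `[<indist V (inl c : world (fence d0 n)) (inl (h d))>]].
have gh d : g (h d) = d.
  rewrite /g; case: pickP => [d' /asboolP /hinj -> //|/(_ d) /asboolP[]].
  exact: indist_refl.
pose f (x : world (fence d0 n)) : world (fence d1 n) :=
  match x with inl c => inl (g c) | inr j => inr j end.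
have fpos x : fence_pos (f x) = fence_pos x by case: x.
have finv (x y : world (fence d0 n)) : indist V x y -> f x = f y.
  move=> xy; have := posE _ _ xy; case: x y xy => [c|j] [c'|j'] //= cc'.
  - move=> _; congr inl; congr odflt; apply: eq_pick => d.
    by apply: asbool_equiv_eq; split; apply: indist_trans => //; exact: indist_sym.
  - by move=> jj'; congr inr; apply: val_inj => /=; lia.
have flift y : exists x, f x = y.
  case: y => [d|j]; first by exists (inl (h d)); rewrite /= gh.
  by exists (inr j).
have [N [e cov]] := fence_covers.
have gU : gsat M (fun q => [set x | U q (f x)]).
  apply: (gsat_definable HM gM) => q; apply: (@cover_definable _ V N e).
    by move=> x; have [j jN ->] := cov x; exists j.
  by move=> x y /finv /= ->.
move=> y a Ma; have [x <-] := flift y.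
apply/(@pmorphism (fence d0 n) (fence d1 n) (fun q => [set x | U q (f x)]) U f) => //.
- by move=> u v uv; rewrite /= !fpos.
- by move=> u v; have [v' <-] := flift v => uv; exists v' => //; move: uv; rewrite /= !fpos.
- by move=> u v; have [v' <-] := flift v => uv; exists v' => //; move: uv; rewrite /= !fpos.
exact: gU.
Qed.

End Cluster.

(** The refutation of [chi] lives on a cluster of finitely many types. A model of [M] with that many
    distinguishable cluster points would map onto it, so there are fewer, besides [n.+1] other
    points. *)
Lemma fence_ext_tabular n M chi : tense_logic M -> consistent M ->
  fence_logic n `<=` M -> M chi -> ~ fence_logic n chi -> tabular M.
Proof.
move=> HM consM LM Mchi /existsNP[U0 /existsNP[x0 nchi]].
(* The extra variable guarantees two distinct types, as [gsat_cluster] demands. *)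
pose k0 := (nvars chi).+1.
have [U1 [x1 [U1E _]]] := fence_types k0 U0 x0.
have {}nchi : ~ sat U1 x1 chi by move=> h; apply: nchi; apply/U1E; rewrite ?leqnSn.
apply: (tabular_bounded (b := #|types k0| + n.+1)) => // phi nphi.
pose k := nvars phi; pose F := fence (type0 k) n.
have [N [X XP]] := @fence_covers (types k) (type0 k) n.
have imF : image_finite F by move=> x; exists N, X => y _; exact: XP.
have [|V [j [_ Mj phij]]] := @compactness F X N M phi imF HM.
  (* [psi] may have variables beyond those of [phi]; its truncation is still a theorem and survives
     the passage to types. *)
  move=> psi Mpsi; have : ~ fence_logic n (Imp (subst (trunc k) psi) phi).
    by move=> /LM /(tl_mp HM (tl_subst HM _ Mpsi)).
  move=> /existsNP[V /existsNP[x /not_implyP[xpsi xphi]]].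
  have [U [y [UE Utrunc]]] := fence_types k V x.
  have [j jN yE] := XP y; exists U, j; rewrite -yE; split=> //.
    by apply/Utrunc/UE => //; exact: nvars_trunc.
  by move=> h; apply: xphi; apply/UE.
have gM : gsat M V.
  by apply: (gsat_reach HM _ Mj) => y; exact: fence_connected.
pose E (c c' : types k) := indist V (inl c : world F) (inl c').
have Etr c c' c'' : E c c' -> E c' c'' -> E c c'' by exact: indist_trans.
have [m [g [_ covg injg]]] : exists m (g : nat -> types k),
    [/\ m <= #|types k|, covers E m g &
    forall i j, i < m -> j < m -> E (g i) (g j) -> i = j].
  apply: (@min_cover _ E _ (nth (type0 k) (enum (types k)))) => // c.
  exists (index c (enum (types k))); first by rewrite cardE index_mem mem_enum.
  by rewrite nth_index ?mem_enum.
have [mK|Km] := ltnP m #|types k0|; last first.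
  exfalso; apply: nchi.
  pose h (d : types k0) := g (enum_rank d).
  pose d2 : types k0 := [ffun => true].
  suff gU1 : gsat M U1 by exact: gU1.
  apply: (@gsat_cluster _ (type0 k) n V _ (type0 k0) d2 h M U1 HM gM).
    by apply/eqP => /ffunP /(_ ord0); rewrite !ffunE.
  move=> d d' /injg h'; apply: enum_rank_inj; apply: val_inj; apply: h'.
    exact: leq_trans (ltn_ord _) Km.
  exact: leq_trans (ltn_ord _) Km.
pose e i : world F := if i < m then inl (g i) else inr (inord (i - m)).
exists F, V, (X j), (m + n.+1), e; split=> //.
  by rewrite leq_add2r ltnW.
case=> [c|i].
  by have [l lm cl] := covg c; exists l; [exact: ltn_addr|rewrite /e lm].
exists (m + i); first by rewrite ltn_add2l.
by rewrite /e ltnNge leq_addr /= addKn inord_val.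
Qed.

Lemma fence_pretabular n : pretabular (fence_logic n).
Proof.
split; [exact: Log_tense|exact: Log_consistent|exact: fence_not_tabular|].
move=> M [HM LM] [_ /existsNP[chi /not_implyP[Mchi nchi]]] consM.
exact: fence_ext_tabular Mchi nchi.
Qed.

(** * Counting pretabular extensions *)

Lemma NExt_fences (P : set nat) : NExt S4t (\bigcap_(n in P) fence_logic n).
Proof.
split; first by apply: tense_bigcap => n _; exact: Log_tense.
by move=> a Sa n _; apply: (proj2 (S4t_line _ _)) Sa.
Qed.

Lemma PTAB_fences (P : set nat) n :
  P n -> PTAB (\bigcap_(n in P) fence_logic n) (fence_logic n).
Proof.
move=> Pn; split; last exact: fence_pretabular.
by split; [exact: Log_tense|exact: bigcap_inf].
Qed.

Lemma PTAB_all_fences M :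
  PTAB (fence_tail 0) M -> (exists n, M = fence_logic n) \/ M = Log zline.
Proof.
move=> [[HM tail0] preM]; have [_ consM ntabM extM] := preM.
have [|/forallNP nfence] := pselect (exists n, M = fence_logic n); first by left.
right; have tail n0 : fence_tail n0 `<=` M.
  have HL n : tense_logic (fence_logic n) by exact: Log_tense.
  have HR : tense_logic (fence_tail n0) by apply: tense_bigcap => n _; exact: HL.
  have [|[n _ LnM]|//] := pretabular_bigcap (n := n0) preM HL HR.
    move=> a [a1 a2]; apply: tail0 => n _.
    by have [nn0|nn0] := ltnP n n0; [exact: a1|exact: a2].
  by case: (nfence n); rewrite (pretabular_eq (fence_pretabular n) preM LnM).
have MZ : M `<=` Log zline.
  move=> chi Mchi; apply: contrapT => nchi; apply: ntabM.
  apply: (zline_ext_tabular HM consM _ Mchi nchi).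
  apply: sub_zline_of_no_mix => // p; exact: no_mix Mchi nchi.
apply/seteqP; split=> //; apply: contrapT => nZM; apply: zline_not_tabular.
by apply: extM => //; [split=> //|exact: Log_consistent]; exact: Log_tense.
Qed.

(** The remainder in the primeness argument is the set of all formulas, which no consistent [M]
    contains. For [n = 0] the intersection is itself inconsistent. *)
Lemma PTAB_first_fences n :
  PTAB (\bigcap_(i in `I_n) fence_logic i) = fence_logic @` `I_n.
Proof.
apply/seteqP; split=> [M [[HM sub] preM]|_ [i i_n <-]]; last exact: PTAB_fences.
have HL i : tense_logic (fence_logic i) by exact: Log_tense.
have HT : tense_logic [set: form] by [].
have [|[i i_n LiM]|TM] := pretabular_bigcap (n := n) preM HL HT.
- by rewrite setIT.
- by exists i => //; exact: pretabular_eq (fence_pretabular i) preM LiM.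
- by have [_ consM _ _] := preM; case: consM; exact: TM.
Qed.

Theorem theorem7p14 (T : Type) (K : set T) (hK : K #<= [set: nat]) :
  exists L : set form, NExt S4t L /\ PTAB L #= K.
Proof.
have [/finite_setP[n Kn]|Kinf] := pselect (finite_set K).
  exists (\bigcap_(i in `I_n) fence_logic i); split; first exact: NExt_fences.
  rewrite PTAB_first_fences (card_eqr Kn).
  by apply: inj_card_eq => i j _ _; exact: fence_logic_inj.
exists (fence_tail 0); split; first exact: NExt_fences.
rewrite (card_eqr (eq_card_nat hK Kinf)); apply: eq_card_nat.
  (* [Log zline] enters as a possible extra element: this enumeration bounds the count from above,
     the fences from below. *)
  pose f n := if n is n'.+1 then fence_logic n' else Log zline.
  apply: card_le_trans (card_image_le f [set: nat]); apply: subset_card_le.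
  by move=> M /PTAB_all_fences[[n ->]|->]; [exists n.+1|exists 0].
apply: (@sub_infinite_set _ (range fence_logic)).
  by move=> _ [n _ <-]; exact: PTAB_fences.
apply/infiniteP; have := @inj_card_eq _ _ [set: nat] fence_logic.
by rewrite card_eq_le => /(_ (in2W fence_logic_inj)) /andP[].
Qed.
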